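(* Let $n \ge 1$ and let $k, \ell$ be nonnegative integers. The number of pairs $(T,v)$ with $T \in \mathcal{T}_n$ and $v$ a vertex of $T$ of outdegree exactly $k$ at level exactly $\ell$ equals $$\frac{k+2\ell}{2n-k}\binom{2n-k}{n+\ell}.$$
   Context: $\mathcal{T}_n$ denotes the set of rooted ordered (plane) trees with $n$ edges. The outdegree of a vertex is its number of children; the level of a vertex is its distance (number of edges) from the root. *)

(* Defs.v *)
From mathcomp Require Import all_boot all_order all_algebra.
From mathcomp Require Import all_classical.

Set Implicit Arguments.
Unset Strict Implicit.
Unset Printing Implicit Defensive.

Local Open Scope nat_scope.

Inductive plane_tree : Type := Node of seq plane_tree.

Definition children (t : plane_tree) : seq plane_tree :=
  let: Node ts := t in ts.

(* Each child contributes its own edges plus the edge joining it to its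
   parent. *)
Fixpoint num_edges (t : plane_tree) : nat :=
  let: Node ts := t in sumn [seq (num_edges u).+1 | u <- ts].

(* A vertex is encoded by its address: the sequence of 0-based child indices
   read along the path from the root; the root has address [::]. The result
   is None when the address leaves the tree. *)
Fixpoint subtree_at (t : plane_tree) (v : seq nat) {struct v} :
    option plane_tree :=
  if v is i :: v' then
    if onth (children t) i is Some u then subtree_at u v' else None
  else Some t.

Definition is_vertex (t : plane_tree) (v : seq nat) : bool :=
  isSome (subtree_at t v).

(* The value 0 on addresses that are not vertices of t is a junk value. *)
Definition outdegree (t : plane_tree) (v : seq nat) : nat :=
  if subtree_at t v is Some u then size (children u) else 0.

(* The path from the root to v is unique and has one edge per index in v. *)
Definition level (v : seq nat) : nat := size v.

Local Open Scope classical_set_scope.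

Definition plane_trees (n : nat) : set plane_tree :=
  [set t | num_edges t = n].

Definition marked_trees (n k l : nat) : set (plane_tree * seq nat) :=
  [set p | [/\ plane_trees n p.1, is_vertex p.1 p.2,
               outdegree p.1 p.2 = k & level p.2 = l]].

(* Main.v *)
Require Import Defs.
From mathcomp Require Import all_boot all_order all_algebra.
From mathcomp Require Import all_classical.
From mathcomp Require Import zify.

(** Cut a plane tree along the path from the root to the marked vertex. A path
vertex above the marked one splits into two trees, formed by the children to
the left and to the right of the path, and the [k] subtrees of the marked
vertex remain. So marked trees correspond to forests of [k + 2 l] trees with
[n - k - l] edges. Removing the first tree of a forest when it is a single
vertex, or else cutting its leftmost root edge, gives the recursion
[F (m + 1, e + 1) = F (m, e + 1) + F (m + 2, e)] for the number of forests,
which is solved by [F (m, e) = m / (2 e + m) * 'C(2 e + m, e)]. *)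

Import GRing.Theory.
Local Open Scope card_scope.
Local Open Scope classical_set_scope.

Lemma card_setU_II (T : Type) (A B : set T) (m n : nat) :
  A `&` B = set0 -> A #= `I_m -> B #= `I_n -> A `|` B #= `I_(m + n).
Proof.
move=> AB0 /card_set_bijP[f [fA fI fS]] /card_set_bijP[g [gA gI gS]].
have notA x : B x -> (x \in A) = false.
  by move=> Bx; apply: memNset => Ax; rewrite -[False]/(set0 x) -AB0.
apply/card_set_bijP; exists (fun x => if x \in A then f x else m + g x).
split.
- move=> x [Ax|Bx] /=; first by rewrite mem_set//; have /= := fA x Ax; lia.
  by rewrite notA //; have /= := gA x Bx; lia.
- move=> x y; rewrite !inE /= => -[Ax|Bx] [Ay|By].
  + by rewrite !mem_set// => /fI; apply; rewrite inE.
  + by rewrite mem_set// notA // => e; have /= := fA x Ax; lia.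
  + by rewrite notA // mem_set// => e; have /= := fA y Ay; lia.
  + by rewrite !notA // => /addnI /gI; apply; rewrite inE.
- move=> i /= ilt; have [im|mi] := ltnP i m.
    by have [x Ax <-] := fS i im; exists x; [left|rewrite mem_set].
  have [|x Bx e] := gS (i - m); first by move=> /=; lia.
  by exists x; [right|rewrite notA // e; lia].
Qed.

Definition forest_edges (s : seq plane_tree) : nat := sumn (map num_edges s).
Arguments forest_edges : simpl never.

Lemma forest_edges_cat s1 s2 :
  forest_edges (s1 ++ s2) = forest_edges s1 + forest_edges s2.
Proof. by rewrite /forest_edges map_cat sumn_cat. Qed.

Lemma forest_edges_cons t s :
  forest_edges (t :: s) = num_edges t + forest_edges s.
Proof. by []. Qed.

Lemma num_edgesE t :
  num_edges t = size (children t) + forest_edges (children t).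
Proof.
by case: t => ts; rewrite /forest_edges /=; elim: ts => //= t ts ->; lia.
Qed.

Arguments num_edges : simpl never.

Definition forests (m e : nat) : set (seq plane_tree) :=
  [set s | size s = m /\ forest_edges s = e].

(** Inverse of cutting the leftmost root edge of the first tree: [t] is hung as first child below
    the root of [u]. Shorter lists are returned unchanged. *)
Definition graft (s : seq plane_tree) : seq plane_tree :=
  if s is t :: u :: s' then Node (t :: children u) :: s' else s.

Lemma forests0n m : forests m.+1 0 = cons (Node [::]) @` forests m 0.
Proof.
apply/seteqP; split=> [[|[[|t ts]] s] [//= szs]|_ [s [/= szs es] <-]].
- by move=> es; exists s => //; split=> //; lia.
- by split; rewrite /= ?szs.
Qed.

Lemma forestsSS m e :
  forests m.+1 e.+1 =
    cons (Node [::]) @` forests m e.+1 `|` graft @` forests m.+2 e.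
Proof.
apply/seteqP; split=> [[|[[|t ts]] s] [//= szs]|x [[s [/= szs es] <-]|]].
- by move=> es; left; exists s => //; split=> //; lia.
- rewrite forest_edges_cons num_edgesE /= => es; right.
  exists (t :: Node ts :: s) => //; split=> /=; first by lia.
  move: es; rewrite !forest_edges_cons (num_edgesE (Node ts)) /=; lia.
- by split; rewrite /= ?szs.
- case=> [[|t [|u s]] [//= szs es] <-]; split=> /=; first by lia.
  move: es; rewrite !forest_edges_cons (num_edgesE u) (num_edgesE (Node _)) /=.
  rewrite forest_edges_cons; lia.
Qed.

(** The restriction to at least two trees matters: a one-tree list is fixed by [graft] and can also
    be the graft of two trees. *)
Lemma graft_inj m e : {in forests m.+2 e &, injective graft}.
Proof.
move=> [|t [|[ts] s]] [|t' [|[ts'] s']]; rewrite !inE => -[//= _ _] [//= _ _].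
by case=> -> -> ->.
Qed.

(* The closed form is multiplied out, so it says nothing at [m = e = 0]. *)
Lemma card_forests e m :
  exists2 N, forests m e #= `I_N & N * (2 * e + m) = m * 'C(2 * e + m, e).
Proof.
elim: e m => [|e IHe] m.
  exists 1; last by rewrite bin0 mul1n muln1.
  elim: m => [|m IHm].
    rewrite (_ : forests 0 0 = [set [::]]); first exact: card_set1.
    by apply/seteqP; split=> [s [/size0nil-> _] //|_ ->].
  rewrite forests0n; apply: card_eq_trans IHm.
  by apply: inj_card_eq => s s' _ _ [].
elim: m => [|m [N1 cN1 eN1]].
  exists 0; last by rewrite mul0n.
  by rewrite II0 card_eq0; apply/eqP/seteqP; split=> [s [/size0nil->]|].
have [N2 cN2 eN2] := IHe m.+2.
exists (N1 + N2).
  rewrite forestsSS; apply: card_setU_II.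
  - apply/seteqP; split=> // s [[s1 _ <-] [[|t [|u s2]] [//=]]].
  - by apply: card_eq_trans cN1; apply: inj_card_eq => s s' _ _ [].
  - by apply: card_eq_trans cN2; apply: inj_card_eq; exact: graft_inj.
(* With [M = 2 * e + m + 2], both counts carry the same factor [M]. After Pascal's rule the goal
   reduces to [(e + 1) * 'C(M, e + 1) = (M - e) * 'C(M, e)]. *)
have := mul_bin_left (2 * e + m.+2) e.
move: eN1 eN2; rewrite (_ : 2 * e.+1 + m = 2 * e + m.+2); last by lia.
rewrite (_ : 2 * e.+1 + m.+1 = (2 * e + m.+2).+1); last by lia.
rewrite binS (_ : 2 * e + m.+2 - e = e + m.+2); last by lia.
move: 'C(_, e.+1) 'C(_, e) => X Y; nia.
Qed.

(** Inverse of cutting along the path: each of the first [l] pairs holds the left and right parts of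
    a path vertex, root first, and the remaining trees hang below the marked vertex. Lists that are
    too short give a junk value. *)
Fixpoint glue (l : nat) (s : seq plane_tree) : plane_tree * seq nat :=
  if l is l'.+1 then
    if s is t :: u :: s' then
      let: (w, v) := glue l' s' in
      (Node (children t ++ w :: children u), size (children t) :: v)
    else (Node s, [::])
  else (Node s, [::]).

(** The edges outside the forest are the [l] path edges and the [size s - 2 * l] edges below the
    marked vertex, hence [size s - l] in all. *)
Lemma glueP l s : 2 * l <= size s ->
  [/\ is_vertex (glue l s).1 (glue l s).2,
      outdegree (glue l s).1 (glue l s).2 = size s - 2 * l,
      level (glue l s).2 = l &
      num_edges (glue l s).1 = size s - l + forest_edges s].
Proof.
elim: l s => [|l IHl] s.
  by move=> _; split=> //; rewrite ?subn0 // num_edgesE.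
case: s => [|t [|u s]] //= szs; try lia.
have := IHl s; case: (glue l s) => w v /= [|vert odeg lev ne]; first by lia.
rewrite /is_vertex /outdegree /= onth_cat ltnn subnn /=; split=> //.
- by rewrite [LHS]odeg; lia.
- by rewrite /level /= -lev.
- rewrite (num_edgesE (Node _)) /= size_cat forest_edges_cat.
  rewrite !forest_edges_cons ne (num_edgesE t) (num_edgesE u) /=; lia.
Qed.

Lemma onth_split (T : Type) (s : seq T) i x :
  onth s i = Some x -> s = take i s ++ x :: drop i.+1 s /\ i < size s.
Proof.
move=> sx; have ilt : i < size s by rewrite -onthTE sx.
by rewrite -(onth_nth x _ _ _ sx) -drop_nth ?cat_take_drop.
Qed.

Lemma glue_surj t v : is_vertex t v ->
  exists2 s, 2 * size v <= size s & glue (size v) s = (t, v).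
Proof.
elim: v t => [|i v IHv] [ts]; first by exists ts.
rewrite /is_vertex /=; case tsi: (onth ts i) => [u|] // /IHv[s szs es].
have [tsE ilt] := onth_split _ _ _ _ tsi.
(* The child at index [i] continues the path; its left and right siblings form the new pair. *)
exists (Node (take i ts) :: Node (drop i.+1 ts) :: s); first by move=> /=; lia.
by rewrite /= es -tsE size_takel // ltnW.
Qed.

Lemma glue_inj l s s' : 2 * l <= size s -> 2 * l <= size s' ->
  glue l s = glue l s' -> s = s'.
Proof.
elim: l s s' => [|l IHl] s s'; first by move=> _ _ [].
case: s => [|[ts] [|[us] s]] /= szs; try lia.
case: s' => [|[ts'] [|[us'] s']] /= szs'; try lia.
have := IHl s s'; case: (glue l s) (glue l s') => w v [w' v'] IH.
(* The first index of the address is the length of the left part, so both child lists split at the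
   same place. *)
case=> E szE vE; move: (congr1 (take (size ts)) E) (congr1 (drop (size ts)) E).
rewrite {2 4}szE !take_size_cat // !drop_size_cat // => -> [wE ->].
by rewrite IH ?wE ?vE //; lia.
Qed.

Lemma marked_trees_glue n k l : k + l <= n ->
  marked_trees n k l = glue l @` forests (k + 2 * l) (n - (k + l)).
Proof.
move=> kln; apply/seteqP; split=> [[t v] [/= ne vert odeg lev]|].
  have [s szs sE] := glue_surj _ _ vert.
  move: (glueP _ _ szs); rewrite sE /= => -[_ odegs _ nes].
  move: ne; rewrite /plane_trees /= => ne.
  have levE : size v = l := lev.
  by exists s; [split; lia | rewrite -levE].
move=> _ [s [szs es] <-].
have [|vert odeg lev ne] := glueP l s; first by lia.
by split=> //; rewrite /plane_trees /=; lia.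
Qed.

(** The path to the marked vertex and the edges to its children already make [k + l] distinct
    edges. *)
Lemma marked_trees_eq0 n k l : n < k + l -> marked_trees n k l = set0.
Proof.
move=> nkl; apply/seteqP; split=> // -[t v] [/= ne vert odeg lev].
have [s szs sE] := glue_surj _ _ vert.
move: (glueP _ _ szs); rewrite sE /= => -[_ odegs _ nes].
by move: ne lev; rewrite /plane_trees /level /=; lia.
Qed.

Local Open Scope ring_scope.

Theorem theorem4p2 (n k l : nat) (hn : (1 <= n)%N) :
  exists2 N : nat,
    marked_trees n k l #= `I_N &
    N%:R = (k + 2 * l)%N%:R / ((2 * n)%N%:R - k%:R)
           * 'C(2 * n - k, n + l)%:R :> rat.
Proof.
have [kln|nkl] := leqP (k + l) n; last first.
  exists 0%N; first by rewrite marked_trees_eq0 // II0.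
  (* The binomial vanishes, so the right side is 0 even when the denominator is 0 or negative. If
     the subtraction truncates to 0, [hn] still gives [0 < n + l]. *)
  by rewrite bin_small ?mulr0 //; lia.
have [N cN eN] := card_forests (n - (k + l)) (k + 2 * l).
exists N.
  rewrite marked_trees_glue //; apply: card_eq_trans cN.
  apply: inj_card_eq => s s'; rewrite !inE => -[szs _] [szs' _].
  by apply: glue_inj; lia.
have szE : (2 * (n - (k + l)) + (k + 2 * l) = 2 * n - k)%N by lia.
(* Symmetry of the binomial: the two lower indices add up to [2 * n - k]. *)
have binE : 'C(2 * n - k, n - (k + l)) = 'C(2 * n - k, n + l).
  by rewrite -bin_sub; [congr 'C(_, _); lia | lia].
rewrite -natrB; last by lia.
move: eN; rewrite szE binE => /(congr1 (fun i : nat => i%:R : rat)).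
(* The denominator is nonzero because [k <= n] and [1 <= n] give [k < 2 * n]. *)
rewrite !natrM mulrAC => <-; rewrite mulfK // Num.Theory.pnatr_eq0; lia.
Qed.
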